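(* Let $\Gamma_{\mathrm{par}}(x,y)=(x,y,y^2)$ in two self-adjoint variables, and set $f(x,y)=xy+yx$. Then $f$ is intrinsically $\Gamma_{\mathrm{par}}$-convex and intrinsically $\Gamma_{\mathrm{par}}$-concave on every real free domain. Nevertheless, there is no ordinary matrix-convex germ $G$ in the independent lifted variables $(x,y,s)$ satisfying $G(x,y,y^2)=f(x,y)$ near $(0,0)$. Thus intrinsic and lift-Cartan $\Gamma$-convexity are different even for nc polynomials and the embedding $\Gamma_{\mathrm{par}}$.
   Context: Points are tuples of bounded self-adjoint operators on a common Hilbert space, of arbitrary dimension; operations are coordinatewise. With $g$ variables, a real free set is a collection of such $g$-tuples invariant under simultaneous unitary conjugation, closed under reducing subspaces and under uniformly bounded direct sums with at most $2^{\aleph_0}$ summands. The uniform nc topology is used: a neighborhood of $X$ contains a norm ball of one fixed radius around every amplification (direct sum of copies) of the unitary orbit of $X$. A (real) free domain is a uniformly open real free set. A self-adjoint free function is a graded self-adjoint-operator-valued map respecting unitary conjugation, direct sums and reducing restrictions. $(X,V)$, $V$ an isometry, is a $\Gamma$-pair if $V^*\Gamma(X)V=\Gamma(V^*XV)$ (coordinatewise). A self-adjoint free function $f$ on $D$ is intrinsically $\Gamma$-convex if $f(V^*XV)\preceq V^*f(X)V$ for every $\Gamma$-pair with both $X,V^*XV\in D$, and intrinsically $\Gamma$-concave if $-f$ is intrinsically $\Gamma$-convex. A matrix-convex germ at a point is a locally bounded self-adjoint free function $G$ on a uniform nc neighborhood $U$ of that point satisfying $G(\sum_\alpha V_\alpha^*X^{(\alpha)}V_\alpha)\preceq\sum_\alpha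 V_\alpha^*G(X^{(\alpha)})V_\alpha$ whenever $\sum_\alpha V_\alpha^*V_\alpha=I$ and the combination is defined in $U$; here the germ is at $(0,0,0)$. A self-adjoint nc function $f$ on a real free set $K$ is lift-Cartan $\Gamma$-convex if near every $X\in K$ there is an ordinary matrix-convex free function $G_X$ in the lifted variables, defined near $\Gamma(X)$, with $f(Y)=G_X(\Gamma(Y))$ for nearby $Y\in K$. *)

(* Defs.v *)
From HB Require Import structures.
From mathcomp Require Import all_boot all_order all_algebra.
From mathcomp Require Import complex sesquilinear.
From mathcomp Require Import boolp classical_sets cardinality reals.
From mathcomp Require Import topology normedtype sequences.

Set Implicit Arguments.
Unset Strict Implicit.
Unset Printing Implicit Defensive.

Import Order.TTheory GRing.Theory Num.Theory Num.Def.
Import numFieldTopology.Exports numFieldNormedType.Exports.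

Local Open Scope ring_scope.
Local Open Scope complex_scope.

Definition dot_norm (R : realType) (H : lmodType R[i])
  (dot : {dot H for conjC}) (u : H) : R[i] := sqrtC (dot u u).

Definition dot_complete (R : realType) (H : lmodType R[i])
    (dot : {dot H for conjC}) : Prop :=
  forall u : nat -> H,
    (forall e : R, 0 < e -> exists N, forall m n, (N <= m)%N -> (N <= n)%N ->
       dot_norm dot (u m - u n) < e%:C) ->
    exists l : H, forall e : R, 0 < e ->
      exists N, forall n, (N <= n)%N -> dot_norm dot (u n - l) < e%:C.

(* The dimension is arbitrary; the inner product is linear in its first
   argument and conjugate-linear in the second. *)
Record hilbert (R : realType) := Hilbert {
  hspace :> lmodType R[i];
  hdot : {dot hspace for conjC};
  hdot_complete : dot_complete hdot }.

Definition hnorm (R : realType) (H : hilbert R) (u : H) : R[i] :=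
  dot_norm (hdot H) u.

Notation "'[ u , v ]" := (hdot _ u v) : ring_scope.

Definition scalar_dot (R : realType) (u v : R[i]^o) : R[i] := u * v^*.

Section ScalarHilbert.
Variable R : realType.

Fact scalar_dot_bilinear :
  bilinear_for *%R (conjC \; *%R) (@scalar_dot R).
Proof.
split=> [v a u w | u a v w]; rewrite /scalar_dot /=.
- by rewrite mulrDl -mulrA.
- by rewrite rmorphD rmorphM /= mulrDr mulrCA.
Qed.

HB.instance Definition _ := bilinear_isBilinear.Build R[i] R[i]^o R[i]^o R[i]
  *%R (conjC \; *%R) (@scalar_dot R) scalar_dot_bilinear.

Fact scalar_dot_hermitian (u v : R[i]^o) :
  scalar_dot u v = (-1) ^+ false * (scalar_dot v u)^*.
Proof. by rewrite /scalar_dot expr0 mul1r rmorphM /= conjCK mulrC. Qed.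

HB.instance Definition _ := isHermitianSesquilinear.Build R[i] R[i]^o
  false conjC (@scalar_dot R) scalar_dot_hermitian.

Fact scalar_dot_gt0 (u : R[i]^o) : u != 0 -> 0 < scalar_dot u u.
Proof. by move=> u0; rewrite /scalar_dot -normCK exprn_gt0 // normr_gt0. Qed.

HB.instance Definition _ := isDotProduct.Build R[i] R[i]^o
  (@scalar_dot R) scalar_dot_gt0.

Let real_cauchy (u : nat -> R) :
  (forall e : R, 0 < e -> exists N, forall m n, (N <= m)%N -> (N <= n)%N ->
     `|u m - u n| < e) ->
  exists l : R, forall e : R, 0 < e ->
    exists N, forall n, (N <= n)%N -> `|u n - l| < e.
Proof.
move=> uC; have : cvgn u.
  apply/cauchy_cvgP/cauchy_exP => e e0; have [N uN] := uC _ e0.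
  by exists (u N); exists N => // n /= Nn; exact: uN.
move=> /cvgrPdist_lt ul; exists (limn u) => e e0.
by have [N _ lN] := ul _ e0; exists N => n Nn; rewrite distrC; apply: lN.
Qed.

Fact scalar_dot_complete : dot_complete (@scalar_dot R : {dot _ for conjC}).
Proof.
have normE (z : R[i]) : dot_norm (@scalar_dot R : {dot _ for conjC}) z = `|z|.
  by rewrite /dot_norm /= /scalar_dot -normCK sqrCK.
have normC_real (a : R) : `|a%:C| = `|a|%:C.
  by rewrite normc_def /= expr0n addr0 sqrtr_sqr.
have ltC (a b : R) : (a%:C < b%:C) = (a < b) by rewrite ltcR.
have normc_ge_Im (z : R[i]) : `|complex.Im z|%:C <= `|z|.
  by case: z => a b; rewrite normc_def lecR -sqrtr_sqr ler_wsqrtr // lerDr sqr_ge0.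
move=> u uC.
have ReB (a b : R[i]) : complex.Re (a - b) = complex.Re a - complex.Re b.
  by case: a b => [? ?] [? ?].
have ImB (a b : R[i]) : complex.Im (a - b) = complex.Im a - complex.Im b.
  by case: a b => [? ?] [? ?].
have [|a ua] := @real_cauchy (fun n => complex.Re (u n)).
  move=> e /uC [N uN]; exists N => m n Nm Nn.
  rewrite -ReB -ltC (le_lt_trans (normc_ge_Re _)) //.
  by have := uN m n Nm Nn; rewrite normE.
have [|b ub] := @real_cauchy (fun n => complex.Im (u n)).
  move=> e /uC [N uN]; exists N => m n Nm Nn.
  rewrite -ImB -ltC (le_lt_trans (normc_ge_Im _)) //.
  by have := uN m n Nm Nn; rewrite normE.
exists (a +i* b) => e e0.
have [|N1 aN] := ua (e / 2); first by rewrite divr_gt0.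
have [|N2 bN] := ub (e / 2); first by rewrite divr_gt0.
exists (maxn N1 N2) => n; rewrite geq_max => /andP[N1n N2n].
rewrite normE [u n - _]complexE ReB ImB /=.
rewrite (le_lt_trans (ler_normD _ _)) // normrM normCi mul1r.
rewrite !normC_real [e]splitr rmorphD ltrD // ltcR; [exact: aN | exact: bN].
Qed.

Definition scalar_hilbert : hilbert R := Hilbert scalar_dot_complete.

End ScalarHilbert.

(* Operators are functions on the underlying spaces, with boundedness and
   self-adjointness as predicates, so that sums and composites need no
   packaging. *)

Definition opnorm_le (R : realType) (H K : hilbert R) (T : H -> K) (M : R) :
  Prop := forall u, hnorm (T u) <= M%:C * hnorm u.

Definition bounded_op (R : realType) (H K : hilbert R) (T : H -> K) : Prop :=
  linear T /\ exists M, opnorm_le T M.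

(* By Riesz representation every bounded [V] has exactly one [W] with
   [adjoint V W], namely its Hilbert-space adjoint. *)
Definition adjoint (R : realType) (H K : hilbert R) (V : H -> K) (W : K -> H) :
  Prop := forall u v, '[V u, v] = '[u, W v].

Definition selfadjoint_op (R : realType) (H : hilbert R) (T : H -> H) : Prop :=
  bounded_op T /\ adjoint T T.

(* Comparison in [R[i]] forces the difference to be real and nonnegative. *)
Definition op_le (R : realType) (H : hilbert R) (S T : H -> H) : Prop :=
  forall u, '[S u, u] <= '[T u, u].

Definition isometric (R : realType) (K H : hilbert R) (V : K -> H) : Prop :=
  linear V /\ forall u v, '[V u, V v] = '[u, v].

Definition unitary_op (R : realType) (K H : hilbert R) (V : K -> H) : Prop :=
  isometric V /\ forall v, exists u, V u = v.

Definition point (R : realType) (g : nat) (H : hilbert R) : Type :=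
  'I_g -> H -> H.

Definition zero_point (R : realType) (g : nat) (H : hilbert R) : point g H :=
  fun _ _ => 0.

Definition sa_point (R : realType) (g : nat) (H : hilbert R) (X : point g H) :
  Prop := forall i, selfadjoint_op (X i).

(* For [V] unitary this says Z = V^* X V.  For [V] isometric and [X]
   self-adjoint it says that the range of [V] reduces [X] and that [Z] is the
   restriction of [X] to it, transported along [V]. *)
Definition intertwines (R : realType) (g : nat) (K H : hilbert R) (V : K -> H)
  (Z : point g K) (X : point g H) : Prop := forall i u, X i (V u) = V (Z i u).

(* [X] is the Hilbert direct sum of the [Xs j] along the embeddings [V j] of
   the summands: isometries with mutually orthogonal ranges whose closed linear
   span is everything.  Boundedness of [X] is uniform boundedness of the
   family. *)
Record dsum_along (R : realType) (g : nat) (J : Type) (Hs : J -> hilbert R)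
    (H : hilbert R) (V : forall j, Hs j -> H)
    (Xs : forall j, point g (Hs j)) (X : point g H) : Prop := DsumAlong {
  dsum_card : ([set: J] #<= [set: set nat])%card;
  dsum_inhabited : inhabited J;
  dsum_isometric : forall j, isometric (V j);
  dsum_orthogonal : forall i j u v, i <> j -> '[V i u, V j v] = 0;
  dsum_total : forall w, (forall j u, '[V j u, w] = 0) -> w = 0;
  dsum_sa : sa_point X;
  dsum_intertwines : forall j, intertwines (V j) (Xs j) X }.

Definition amplification (R : realType) (g : nat) (H : hilbert R)
    (X : point g H) (K : hilbert R) (Y : point g K) : Prop :=
  exists (J : Type) (V : J -> H -> K), dsum_along V (fun=> X) Y.

Definition ncset (R : realType) (g : nat) : Type :=
  forall H : hilbert R, point g H -> Prop.

Record real_free_set (R : realType) (g : nat) (D : ncset R g) : Prop :=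
  RealFreeSet {
    free_sa : forall H (X : point g H), D H X -> sa_point X;
    free_unitary : forall (K H : hilbert R) (V : K -> H) Z X,
      unitary_op V -> intertwines V Z X -> sa_point Z -> D H X -> D K Z;
    free_reducing : forall (K H : hilbert R) (V : K -> H) Z X,
      isometric V -> intertwines V Z X -> sa_point Z -> D H X -> D K Z;
    free_dsum : forall (J : Type) (Hs : J -> hilbert R) (H : hilbert R)
        (V : forall j, Hs j -> H) Xs X,
      dsum_along V Xs X -> (forall j, D (Hs j) (Xs j)) -> D H X }.

(* [U] is a neighborhood of [X] for the uniform nc topology.  Amplifications
   are only determined up to unitary equivalence, so the unitary orbit of [X]
   is included. *)
Definition unc_nbhd (R : realType) (g : nat) (H : hilbert R) (X : point g H)
    (U : ncset R g) : Prop :=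
  (forall K (Y : point g K), U K Y -> sa_point Y) /\
  exists2 r : R, 0 < r &
    forall (K : hilbert R) (X' Y : point g K), amplification X X' ->
      sa_point Y -> (forall i, opnorm_le (fun u => Y i u - X' i u) r) -> U K Y.

Definition real_free_domain (R : realType) (g : nat) (D : ncset R g) : Prop :=
  real_free_set D /\ forall H (X : point g H), D H X -> unc_nbhd X D.

(* Only the values on the domain matter. *)
Definition ncfun (R : realType) (g : nat) : Type :=
  forall H : hilbert R, point g H -> H -> H.

Record sa_free_function (R : realType) (g : nat) (D : ncset R g)
    (f : ncfun R g) : Prop := SaFreeFunction {
  freefun_sa : forall H X, D H X -> selfadjoint_op (f H X);
  freefun_unitary : forall (K H : hilbert R) (V : K -> H) Z X,
    unitary_op V -> intertwines V Z X -> D K Z -> D H X ->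
    forall u, f H X (V u) = V (f K Z u);
  freefun_reducing : forall (K H : hilbert R) (V : K -> H) Z X,
    isometric V -> intertwines V Z X -> D K Z -> D H X ->
    forall u, f H X (V u) = V (f K Z u);
  freefun_dsum : forall (J : Type) (Hs : J -> hilbert R) (H : hilbert R)
      (V : forall j, Hs j -> H) Xs X,
    dsum_along V Xs X -> (forall j, D (Hs j) (Xs j)) -> D H X ->
    forall j u, f H X (V j u) = V j (f (Hs j) (Xs j) u) }.

Definition ncfun_opp (R : realType) (g : nat) (f : ncfun R g) : ncfun R g :=
  fun H X u => - f H X u.

Definition ncmap (R : realType) (g k : nat) : Type :=
  forall H : hilbert R, point g H -> point k H.

(* W X V, to be used with W = V^*. *)
Definition compress (R : realType) (g : nat) (K H : hilbert R) (V : K -> H)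
  (W : H -> K) (X : point g H) : point g K := fun i u => W (X i (V u)).

Definition Gamma_pair (R : realType) (g k : nat) (Gamma : ncmap R g k)
    (K H : hilbert R) (V : K -> H) (W : H -> K) (X : point g H) : Prop :=
  [/\ isometric V, adjoint V W &
      forall i u,
        compress V W (Gamma H X) i u = Gamma K (compress V W X) i u].

Definition intrinsically_convex (R : realType) (g k : nat)
    (Gamma : ncmap R g k) (D : ncset R g) (f : ncfun R g) : Prop :=
  sa_free_function D f /\
  forall (K H : hilbert R) (V : K -> H) (W : H -> K) (X : point g H),
    Gamma_pair Gamma V W X -> D H X -> D K (compress V W X) ->
    op_le (f K (compress V W X)) (fun u => W (f H X (V u))).

Definition intrinsically_concave (R : realType) (g k : nat)
    (Gamma : ncmap R g k) (D : ncset R g) (f : ncfun R g) : Prop :=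
  intrinsically_convex Gamma D (ncfun_opp f).

Definition locally_bounded (R : realType) (g : nat) (U : ncset R g)
    (G : ncfun R g) : Prop :=
  forall H (X : point g H), U H X ->
    exists (N : ncset R g) (M : R), unc_nbhd X N /\
      forall K (Y : point g K), N K Y -> U K Y -> opnorm_le (G K Y) M.

(* Finite matrix-convex combinations whose value lies in [U]. *)
Definition matrix_convex (R : realType) (g : nat) (U : ncset R g)
    (G : ncfun R g) : Prop :=
  forall (n : nat) (K : hilbert R) (Hs : 'I_n -> hilbert R)
      (V : forall a, K -> Hs a) (W : forall a, Hs a -> K)
      (Xs : forall a, point g (Hs a)),
    let Z : point g K := fun i u => \sum_a compress (V a) (W a) (Xs a) i u in
    (forall a, bounded_op (V a)) -> (forall a, adjoint (V a) (W a)) ->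
    (forall u, \sum_a W a (V a u) = u) ->
    (forall a, U (Hs a) (Xs a)) -> U K Z ->
    op_le (G K Z) (fun u => \sum_a W a (G (Hs a) (Xs a) (V a u))).

Definition matrix_convex_near (R : realType) (g : nat) (H : hilbert R)
    (P : point g H) (U : ncset R g) (G : ncfun R g) : Prop :=
  [/\ unc_nbhd P U, sa_free_function U G & matrix_convex U G].

Definition matrix_convex_germ (R : realType) (g : nat) (H : hilbert R)
    (P : point g H) (U : ncset R g) (G : ncfun R g) : Prop :=
  matrix_convex_near P U G /\ locally_bounded U G.

(* f(Y) = G(Gamma(Y)) for the points [Y] of [D] near [X], the right-hand side
   being defined there. *)
Definition factors_near (R : realType) (g k : nat) (Gamma : ncmap R g k)
    (D : ncset R g) (f : ncfun R g) (H : hilbert R) (X : point g H)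
    (U : ncset R k) (G : ncfun R k) : Prop :=
  exists2 N : ncset R g, unc_nbhd X N &
    forall (K : hilbert R) (Y : point g K), N K Y -> D K Y ->
      U K (Gamma K Y) /\ f K Y =1 G K (Gamma K Y).

Definition lift_cartan_convex (R : realType) (g k : nat)
    (Gamma : ncmap R g k) (D : ncset R g) (f : ncfun R g) : Prop :=
  sa_free_function D f /\
  forall H (X : point g H), D H X ->
    exists (U : ncset R k) (G : ncfun R k),
      matrix_convex_near (Gamma H X) U G /\ factors_near Gamma D f X U G.

Inductive ncpoly (R : realType) (g : nat) : Type :=
| NCvar of 'I_g
| NCconst of R[i]
| NCadd of ncpoly R g & ncpoly R g
| NCmul of ncpoly R g & ncpoly R g.

Arguments NCvar {R g}.
Arguments NCconst {R g}.

Fixpoint nceval (R : realType) (g : nat) (p : ncpoly R g) : ncfun R g :=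
  fun H X u =>
    match p with
    | NCvar i => X i u
    | NCconst c => c *: u
    | NCadd p q => nceval p X u + nceval q X u
    | NCmul p q => nceval p X (nceval q X u)
    end.

Definition all_points (R : realType) (g : nat) : ncset R g :=
  fun H X => sa_point X.

Definition Gamma_par (R : realType) : ncmap R 2 3 :=
  fun H X => tnth [tuple X 0; X 1; X 1 \o X 1].

Definition par_poly (R : realType) : ncpoly R 2 :=
  let x := NCvar 0 in let y := NCvar 1 in NCadd (NCmul x y) (NCmul y x).

Definition f_par (R : realType) : ncfun R 2 := nceval (par_poly R).

Arguments zero_point {R} g H.
Arguments nceval {R g} p H X u.
Arguments all_points : clear implicits.
Arguments Gamma_par : clear implicits.
Arguments f_par : clear implicits.

(* Main.v *)
From HB Require Import structures.
From mathcomp Require Import all_boot all_order all_algebra.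
From mathcomp Require Import complex sesquilinear ring lra.
From mathcomp Require Import boolp classical_sets cardinality reals.
Require Import Defs.

(** Both halves come from looking at what the third coordinate of the embedding
controls.

For a pair [(X, V)] the [y^2]-coordinate of the pair condition reads
[V^* Y^2 V = (V^* Y V)^2].  Since [|Y V u|^2 - |V^* Y V u|^2] is the squared
norm of the component of [Y V u] orthogonal to the range of [V], the condition
says precisely that [Y V u] stays in that range, i.e. [Y V = V (V^* Y V)]
([square_compression_reducing]).  Every word of [x y + y x] is linear in [x], so
this alone makes the polynomial commute with the compression
([f_par_Gamma_pair]): both convexity and concavity hold, with equality.

In the lifted variables, [s] is no longer tied to [y], which breaks convexity.
Let [Q] be the self-adjoint unitary exchanging the two summands of [H + H].  The
pair [X = - d Q], [Y = t Q] has [Y^2 = t^2 I] and [f(X, Y) = - 2 d t I], while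
its compression to one summand is [(0, 0)].  Hence a convex [G] factoring [f]
would satisfy [G(0, 0, t^2) <= - 2 d t] for all small [t > 0], with [d] fixed;
also [G(0, 0, 0) = 0].  A convex function finite on both sides of [0] cannot
drop from its value at [0] like a square root, because the chord from a fixed
point [- r] gives a lower bound that is linear in [t^2].  These two steps are
merged into one matrix convex combination of value zero, of [(X, Y, Y^2)] and
[(0, 0, - r)] ([matrix_convex_square_axis]); it yields [2 d r <= t C] with [C]
independent of [t], which fails as [t] tends to [0] ([no_matrix_convex_lift]).

The set of all self-adjoint pairs is then a domain on which the two notions of
convexity differ, since a lift near the origin is excluded. *)

Set Implicit Arguments.
Unset Strict Implicit.
Unset Printing Implicit Defensive.

Import Order.TTheory GRing.Theory Num.Theory Num.Def.

Local Open Scope ring_scope.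
Local Open Scope complex_scope.

(** * Bounded operators and adjoints *)

Section Operators.
Variable R : realType.
Implicit Types H K L : hilbert R.

Lemma linear_opD (U V : lmodType R[i]) (T : U -> V) :
  linear T -> {morph T : u v / u + v}.
Proof. by move=> lT u v; have := lT 1 u v; rewrite !scale1r. Qed.

Lemma linear_op0 (U V : lmodType R[i]) (T : U -> V) : linear T -> T 0 = 0.
Proof.
by move=> lT; apply: (addIr (T 0)); rewrite -(linear_opD lT) !add0r.
Qed.

Lemma linear_opZ (U V : lmodType R[i]) (T : U -> V) a u :
  linear T -> T (a *: u) = a *: T u.
Proof.
by move=> lT; have := lT a u 0; rewrite !addr0 (linear_op0 lT) addr0.
Qed.

Lemma dotC H (u v : H) : '[u, v] = ('[v, u])^*.
Proof. by rewrite hermC expr0 mul1r. Qed.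

Lemma dot_extl H (a b : H) : (forall v, '[a, v] = '[b, v]) -> a = b.
Proof.
move=> ab; apply/eqP; rewrite -subr_eq0 -(dnorm_eq0 (hdot H)).
by rewrite linearBl /= ab subrr.
Qed.

Lemma adjoint_sym H K (V : H -> K) (W : K -> H) : adjoint V W -> adjoint W V.
Proof. by move=> VW u v; rewrite dotC -VW -dotC. Qed.

Lemma adjoint_linear H K (V : H -> K) (W : K -> H) : adjoint V W -> linear W.
Proof.
move=> /adjoint_sym VW a u v; apply: dot_extl => w.
by rewrite VW !linearPl /= !VW.
Qed.

Lemma hnorm_ge0 H (u : H) : 0 <= hnorm u.
Proof. by rewrite /hnorm /dot_norm sqrtC_ge0 dnorm_ge0. Qed.

Lemma hnorm_sqr H (u : H) : hnorm u ^+ 2 = '[u, u].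
Proof. by rewrite /hnorm /dot_norm sqrtCK. Qed.

Lemma opnorm_leW H K (T : H -> K) (M N : R) :
  M <= N -> opnorm_le T M -> opnorm_le T N.
Proof.
move=> MN TM u; apply: le_trans (TM u) _.
by rewrite ler_wpM2r ?hnorm_ge0 // lecR.
Qed.

(** Squared norms are inner products, so bounds in this form can be checked
bilinearly, with no square roots. *)
Lemma opnorm_le_sqr H K (T : H -> K) (M : R) : 0 <= M ->
  opnorm_le T M <-> forall u, '[T u, T u] <= (M ^+ 2)%:C * '[u, u].
Proof.
move=> M0; have M0C : 0 <= M%:C by rewrite (lecR 0).
have E u : (hnorm (T u) <= M%:C * hnorm u)
    = ('[T u, T u] <= (M ^+ 2)%:C * '[u, u]).
  rewrite -!hnorm_sqr rmorphXn /= -exprMn ler_pXn2r // nnegrE ?hnorm_ge0 //.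
  by rewrite mulr_ge0 ?hnorm_ge0.
by split=> TM u; have := TM u; rewrite E.
Qed.

Lemma bounded_op_comp H K L (S : K -> L) (T : H -> K) :
  bounded_op S -> bounded_op T -> bounded_op (S \o T).
Proof.
move=> [lS [M SM]] [lT [N TN]]; split.
  by move=> a u v; rewrite /= lT lS.
exists (`|M| * N) => u; have /(_ (T u)) := opnorm_leW (ler_norm M) SM.
move=> /le_trans -> //; rewrite rmorphM /= -mulrA ler_wpM2l ?TN //.
by rewrite (lecR 0).
Qed.

(** The parallelogram bound [|a + b|^2 <= 2 (|a|^2 + |b|^2)] replaces the
triangle inequality: only the existence of a bound matters. *)
Lemma bounded_op_add H K (S T : H -> K) :
  bounded_op S -> bounded_op T -> bounded_op (fun u => S u + T u).
Proof.
move=> [lS [M SM]] [lT [N TN]]; split.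
  by move=> a u v; rewrite lS lT scalerDr addrACA.
have /opnorm_le_sqr : opnorm_le S `|M| by exact: opnorm_leW (ler_norm _) SM.
move=> /(_ (normr_ge0 _)) S2.
have /opnorm_le_sqr : opnorm_le T `|N| by exact: opnorm_leW (ler_norm _) TN.
move=> /(_ (normr_ge0 _)) T2.
exists (2 * (`|M| + `|N|)); apply/opnorm_le_sqr.
  by rewrite mulr_ge0 // addr_ge0.
move=> u; have par : '[S u + T u, S u + T u] <= 2 * ('[S u, S u] + '[T u, T u]).
  rewrite -subr_ge0; apply: le_trans (dnorm_ge0 (hdot K) (S u - T u)) _.
  rewrite le_eqVlt; apply/orP; left; apply/eqP.
  by rewrite !linearBl !linearDl /= !linearBr !linearDr /=; ring.
apply: le_trans par _; have uu := dnorm_ge0 (hdot H) u.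
apply: (@le_trans _ _ (2 * (((`|M| ^+ 2)%:C + (`|N| ^+ 2)%:C) * '[u, u]))).
  by rewrite ler_wpM2l // mulrDl lerD.
rewrite mulrA ler_wpM2r // -[2]/(2%:R : R[i]) -(rmorph_nat (real_complex R)).
rewrite -rmorphD -rmorphM lecR.
have := normr_ge0 M; have := normr_ge0 N; nra.
Qed.

Lemma selfadjoint_anticommutator H (X Y : H -> H) :
  selfadjoint_op X -> selfadjoint_op Y ->
  selfadjoint_op (fun u => X (Y u) + Y (X u)).
Proof.
move=> [bX aX] [bY aY]; split.
  by apply: bounded_op_add; exact: bounded_op_comp.
move=> u v; rewrite linearDl /= linearDr /=.
by rewrite !(aX, aY) addrC.
Qed.

(** * Intrinsic convexity and concavity of the anticommutator *)

Lemma f_parE H (X : point 2 H) u : f_par R H X u = X 0 (X 1 u) + X 1 (X 0 u).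
Proof. by []. Qed.

Lemma f_par_intertwines H K (V : K -> H) Z X : linear V -> intertwines V Z X ->
  forall u, f_par R H X (V u) = V (f_par R K Z u).
Proof. by move=> lV ZX u; rewrite !f_parE !ZX (linear_opD lV). Qed.

Lemma selfadjoint_opp H (T : H -> H) :
  selfadjoint_op T -> selfadjoint_op (fun u => - T u).
Proof.
move=> [[lT [M TM]] aT]; split; first split.
- by move=> a u v; rewrite lT opprD scalerN.
- exists M => u; apply: le_trans (TM u).
  by rewrite /hnorm /dot_norm hnormN.
- by move=> u v; rewrite linearNl linearNr /= aT.
Qed.

Lemma sa_free_function_opp g (D : ncset R g) f :
  sa_free_function D f -> sa_free_function D (ncfun_opp f).
Proof.
move=> [fsa fun_ fred fds].
have opp_iso K H (V : K -> H) (a : H) (b : K) :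
    linear V -> a = V b -> - a = V (- b).
  by move=> lV ->; rewrite -scaleN1r -(linear_opZ _ _ lV) scaleN1r.
split.
- by move=> H X /fsa/selfadjoint_opp.
- move=> K H V Z X uV ZX DZ DX u; apply: opp_iso; first by case: uV => -[].
  exact: fun_.
- move=> K H V Z X iV ZX DZ DX u; apply: opp_iso; first by case: iV.
  exact: fred.
- move=> J Hs H V Xs X dX DXs DX j u; apply: opp_iso.
    by case: (dsum_isometric dX j).
  exact: fds dX DXs DX j u.
Qed.

Lemma f_par_sa_free (D : ncset R 2) :
  (forall H X, D H X -> sa_point X) -> sa_free_function D (f_par R).
Proof.
move=> Dsa; split.
- by move=> H X /Dsa saX; apply: selfadjoint_anticommutator.
- by move=> K H V Z X [[lV _] _] ZX _ _; exact: f_par_intertwines.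
- by move=> K H V Z X [lV _] ZX _ _; exact: f_par_intertwines.
- move=> J Hs H V Xs X dX _ _ j; apply: f_par_intertwines.
    by case: (dsum_isometric dX j).
  exact: dsum_intertwines dX j.
Qed.

(** With [W = V^*], the defect [|Y V u|^2 - |W Y V u|^2] equals
[<(W Y^2 V - (W Y V)^2) u, u>], which vanishes; it is also the squared distance
from [Y V u] to the range of [V]. *)
Lemma square_compression_reducing H K (V : K -> H) (W : H -> K) (Y : H -> H) :
  isometric V -> adjoint V W -> selfadjoint_op Y ->
  (forall u, W (Y (Y (V u))) = W (Y (V (W (Y (V u)))))) ->
  forall u, Y (V u) = V (W (Y (V u))).
Proof.
move=> [_ iV] VW [_ aY] YY u; have WV := adjoint_sym VW.
set w := Y (V u).
have e : '[w, w] = '[W w, W w].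
  by rewrite {1}/w aY -/w VW YY -VW -aY -/w -WV.
apply/eqP; rewrite -subr_eq0 -(dnorm_eq0 (hdot H)).
rewrite linearBl linearBr linearBr /= iV VW -WV e.
by rewrite !subrr.
Qed.

(** In [V^* X Y V] the relation [Y V = V (V^* Y V)] applies to the right end of
the word; in [V^* Y X V] its adjoint [V^* Y = (V^* Y V) V^*] applies to the left
end. *)
Lemma f_par_Gamma_pair H K (V : K -> H) (W : H -> K) (X : point 2 H) :
  sa_point X -> Gamma_pair (Gamma_par R) V W X ->
  forall u, f_par R K (compress V W X) u = W (f_par R H X (V u)).
Proof.
move=> saX [iV VW GX] u; have lW := adjoint_linear VW.
have red : forall u, X 1 (V u) = V (W (X 1 (V u))).
  apply: square_compression_reducing iV VW (saX 1) _ => v.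
  exact: GX (2 : 'I_3) v.
have WV := adjoint_sym VW; have [_ aY] := saX 1.
rewrite !f_parE /compress (linear_opD lW) -red; congr (_ + _).
by apply: dot_extl => v; rewrite !WV !aY VW WV -red.
Qed.

Lemma f_par_Gamma_affine (D : ncset R 2) :
  (forall H X, D H X -> sa_point X) ->
  intrinsically_convex (Gamma_par R) D (f_par R) /\
  intrinsically_concave (Gamma_par R) D (f_par R).
Proof.
move=> Dsa; have fsa := f_par_sa_free Dsa; split; split => //.
- by move=> K H V W X GX DX _ u; rewrite f_par_Gamma_pair //; exact: Dsa.
- exact: sa_free_function_opp.
- move=> K H V W X GX DX _ u.
  rewrite /ncfun_opp f_par_Gamma_pair //; last exact: Dsa.
  have [_ VW _] := GX; rewrite -scaleN1r -[- f_par _ _ _ _]scaleN1r.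
  by rewrite (linear_opZ _ _ (adjoint_linear VW)).
Qed.

Lemma all_points_domain g : real_free_domain (all_points R g).
Proof.
split; last by move=> H X saX; split=> //; exists 1.
by split=> // J Hs H V Xs X dX _; exact: dsum_sa dX.
Qed.

End Operators.

(** * Direct sum of two Hilbert spaces *)

Definition sum_dot (R : realType) (H K : hilbert R) (u v : H * K) : R[i] :=
  '[u.1, v.1] + '[u.2, v.2].

Section DirectSum.
Variables (R : realType) (H K : hilbert R).
Implicit Types u v w : (H * K)%type.

Fact sum_dot_bilinear : bilinear_for *%R (conjC \; *%R) (@sum_dot R H K).
Proof.
split=> [w a u v | u a v w]; rewrite /sum_dot /=.
- by rewrite !linearPl /= mulrDr addrACA.
- by rewrite !linearPr /= mulrDr addrACA.
Qed.

HB.instance Definition _ := bilinear_isBilinear.Build R[i] (H * K)%type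
  (H * K)%type R[i] *%R (conjC \; *%R) (@sum_dot R H K) sum_dot_bilinear.

Fact sum_dot_hermitian u v :
  sum_dot u v = (-1) ^+ false * (sum_dot v u)^*.
Proof.
by rewrite expr0 mul1r /sum_dot rmorphD; congr (_ + _); exact: dotC.
Qed.

HB.instance Definition _ := isHermitianSesquilinear.Build R[i] (H * K)%type
  false conjC (@sum_dot R H K) sum_dot_hermitian.

Fact sum_dot_gt0 u : u != 0 -> 0 < sum_dot u u.
Proof.
move=> u0; rewrite lt_def addr_ge0 ?dnorm_ge0 // andbT.
apply: contraNneq u0; case: u => a b; rewrite /sum_dot /= => /eqP.
rewrite paddr_eq0 ?dnorm_ge0 // !dnorm_eq0 => /andP[/eqP-> /eqP->].
exact/eqP.
Qed.

HB.instance Definition _ := isDotProduct.Build R[i] (H * K)%type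
  (@sum_dot R H K) sum_dot_gt0.

Fact sum_dot_complete : dot_complete (@sum_dot R H K : {dot _ for conjC}).
Proof.
pose d := @sum_dot R H K : {dot _ for conjC}.
have dE u : dot_norm d u ^+ 2 = hnorm u.1 ^+ 2 + hnorm u.2 ^+ 2.
  by rewrite /dot_norm sqrtCK !hnorm_sqr.
have d_ge0 u : 0 <= dot_norm d u by rewrite /dot_norm sqrtC_ge0 dnorm_ge0.
have fst_le u : hnorm u.1 <= dot_norm d u.
  by rewrite -(ler_pXn2r (ltn0Sn 1)) ?nnegrE ?hnorm_ge0 // dE lerDl
    exprn_ge0 ?hnorm_ge0.
have snd_le u : hnorm u.2 <= dot_norm d u.
  by rewrite -(ler_pXn2r (ltn0Sn 1)) ?nnegrE ?hnorm_ge0 // dE lerDr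
    exprn_ge0 ?hnorm_ge0.
move=> u uC.
have [|a ua] := @hdot_complete R H (fst \o u).
  move=> e /uC[N uN]; exists N => m n Nm Nn.
  exact: le_lt_trans (fst_le (u m - u n)) (uN m n Nm Nn).
have [|b ub] := @hdot_complete R K (snd \o u).
  move=> e /uC[N uN]; exists N => m n Nm Nn.
  exact: le_lt_trans (snd_le (u m - u n)) (uN m n Nm Nn).
exists (a, b) => e e0.
have [|N1 aN] := ua (e / 2); first by rewrite divr_gt0.
have [|N2 bN] := ub (e / 2); first by rewrite divr_gt0.
exists (maxn N1 N2) => n; rewrite geq_max => /andP[/aN aNn /bN bNn].
have e0C : 0 < e%:C by rewrite (ltcR 0).
rewrite -(ltr_pXn2r (ltn0Sn 1)) ?nnegrE ?(ltW e0C) // dE.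
have e20 : 0 <= (e / 2)%:C by rewrite (lecR 0) divr_ge0 // ltW.
have ha : hnorm (u n - (a, b)).1 ^+ 2 < (e / 2)%:C ^+ 2.
  by rewrite ltr_pXn2r // nnegrE ?hnorm_ge0.
have hb : hnorm (u n - (a, b)).2 ^+ 2 < (e / 2)%:C ^+ 2.
  by rewrite ltr_pXn2r // nnegrE ?hnorm_ge0.
apply: lt_le_trans (ltrD ha hb) _.
rewrite -!rmorphXn -rmorphD lecR; nra.
Qed.

Definition direct_sum : hilbert R := Hilbert sum_dot_complete.

End DirectSum.

(** * Neighborhoods of the zero tuple *)

Section Germ.
Variable R : realType.
Implicit Types H K : hilbert R.

Lemma sa_zero g H : sa_point (zero_point g H : point g H).
Proof.
move=> i; split; [split|].
- by move=> a u v; rewrite /zero_point scaler0 addr0.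
- exists 0 => u; rewrite /zero_point /hnorm /dot_norm linear0l sqrtC0.
  by rewrite mul0r.
- by move=> u v; rewrite /zero_point linear0l linear0r.
Qed.

Lemma countable_le_continuum (J : countType) :
  ([set: J] #<= [set: set nat])%card.
Proof.
apply/pcard_injP; exists (fun j => [set pickle j]%classic) => i j _ _ ij.
apply: (pcan_inj pickleK).
by have : [set pickle j]%classic (pickle i) by rewrite -ij.
Qed.

Lemma amplification_zero g H : amplification (zero_point g H) (zero_point g H).
Proof.
exists unit, (fun=> id); split.
- exact: countable_le_continuum.
- by split.
- by [].
- by case=> -[].
- by move=> w /(_ tt w)/eqP; rewrite dnorm_eq0 => /eqP.
- exact: sa_zero.
- by [].
Qed.

(** Neighborhoods of the zero tuple of [H] thereby also contain points on
[H + H], where the test points live. *)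
Lemma amplification_zero_sum g H :
  amplification (zero_point g H) (zero_point g (direct_sum H H)).
Proof.
exists bool, (fun b u => if b then (u, 0) else (0, u)); split.
- exact: countable_le_continuum.
- by split; exact: true.
- case; split=> [a u v|u v].
  + by congr (_, _); rewrite /= scaler0 addr0.
  + by rewrite /= /sum_dot /= linear0l addr0.
  + by congr (_, _); rewrite /= scaler0 addr0.
  + by rewrite /= /sum_dot /= linear0l add0r.
- by do 2![case] => // u v _; rewrite /= /sum_dot /= linear0l linear0r addr0.
- case=> a b ab; congr (_, _).
    have /eqP := ab true a.
    by rewrite /= /sum_dot /= linear0l addr0 dnorm_eq0 => /eqP.
  have /eqP := ab false b.
  by rewrite /= /sum_dot /= linear0l add0r dnorm_eq0 => /eqP.
- exact: sa_zero.
- by move=> [] i u.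
Qed.

Lemma unc_nbhd_zero g H U : unc_nbhd (zero_point g H) U ->
  exists2 r : R, 0 < r & forall (K : hilbert R) (Y : point g K),
    amplification (zero_point g H) (zero_point g K) ->
    sa_point Y -> (forall i, opnorm_le (Y i) r) -> U K Y.
Proof.
move=> [_ [r r0 rU]]; exists r => // K Y am saY Yr; apply: rU am saY _ => i u.
by rewrite /zero_point subr0; exact: Yr.
Qed.

(** * The test points and their compressions *)

Definition swap_op H (a : R) (u : direct_sum H H) : direct_sum H H :=
  (a%:C *: u.2, a%:C *: u.1).

Definition scale_op H (a : R) (u : H) : H := a%:C *: u.

Lemma conj_realC (a : R) : conjC a%:C = a%:C :> R[i].
Proof. by apply/CrealP; rewrite complex_real. Qed.

Lemma scale_realA H (a b : R) (u : H) :
  a%:C *: (b%:C *: u) = (a * b)%:C *: u.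
Proof. by rewrite scalerA -rmorphM. Qed.

Lemma dot_realZ H (a : R) (u v : H) : '[a%:C *: u, v] = '[u, a%:C *: v].
Proof. by rewrite linearZl_LR linearZr_LR /= conj_realC. Qed.

Lemma dot_realZZ H (a : R) (u : H) :
  '[a%:C *: u, a%:C *: u] = (a ^+ 2)%:C * '[u, u].
Proof.
by rewrite linearZl_LR linearZr_LR /= conj_realC mulrA -rmorphM expr2.
Qed.

Lemma opnorm_swap H a : opnorm_le (@swap_op H a) `|a|.
Proof.
apply/opnorm_le_sqr => // u; rewrite /= /sum_dot /= !dot_realZZ.
by rewrite -mulrDr addrC real_normK ?num_real.
Qed.

Lemma opnorm_scale H a : opnorm_le (@scale_op H a) `|a|.
Proof.
by apply/opnorm_le_sqr => // u; rewrite dot_realZZ real_normK ?num_real.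
Qed.

Lemma swap_sa H a : selfadjoint_op (@swap_op H a).
Proof.
split; [split; last by exists `|a|; exact: opnorm_swap|].
  move=> b u v; congr (_, _); rewrite /= scalerDr !scalerA mulrC //.
move=> u v; rewrite /= /sum_dot /= addrC; congr (_ + _); exact: dot_realZ.
Qed.

Lemma scale_sa H a : selfadjoint_op (@scale_op H a).
Proof.
split; [split; last by exists `|a|; exact: opnorm_scale|].
  by move=> b u v; rewrite /scale_op scalerDr !scalerA mulrC.
move=> u v; exact: dot_realZ.
Qed.

(** The opposite signs make the anticommutator negative; the sizes [d] and [t]
are kept apart because [d] stays fixed while [t] tends to zero. *)
Definition swap_pair H (d t : R) : point 2 (direct_sum H H) :=
  fun i => if i == 0 then swap_op (- d) else swap_op t.

Definition square_axis H (s : R) : point 3 H :=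
  fun i => if i == 2 then scale_op s else fun=> 0.

Lemma f_par_swap_pair H d t u :
  f_par R _ (@swap_pair H d t) u = (- (2 * d * t))%:C *: u.
Proof.
rewrite f_parE /swap_pair /= /swap_op /=; case: u => a b.
congr (_, _); rewrite /= !scale_realA -scalerDl -rmorphD;
  by congr (_%:C *: _); ring.
Qed.

Lemma Gamma_par_zero H :
  Gamma_par R H (zero_point 2 H) = zero_point 3 H.
Proof. by apply/funext; case; case=> [|[|[|]]]. Qed.

Lemma sa_swap_pair H d t : sa_point (@swap_pair H d t).
Proof. by move=> i; rewrite /swap_pair; case: ifP => _; exact: swap_sa. Qed.

Lemma sa_square_axis H s : sa_point (@square_axis H s).
Proof.
move=> i; rewrite /square_axis; case: ifP => _; first exact: scale_sa.
exact: (sa_zero H i).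
Qed.

Definition corner H (c : R) (u : H) : direct_sum H H := (c%:C *: u, 0).
Definition corner_adj H (c : R) (w : direct_sum H H) : H := c%:C *: w.1.

Lemma corner_adjoint H c : adjoint (@corner H c) (@corner_adj H c).
Proof.
by move=> u v; rewrite /= /sum_dot /= linear0l addr0; exact: dot_realZ.
Qed.

Lemma corner_bounded H c : bounded_op (@corner H c).
Proof.
split.
  move=> a u v; congr (_, _); rewrite /= ?scaler0 ?addr0 //.
  by rewrite scalerDr !scalerA mulrC.
exists `|c|; apply/opnorm_le_sqr => // u.
by rewrite /= /sum_dot /= linear0l addr0 dot_realZZ real_normK ?num_real.
Qed.

(** The exchange of the summands has no diagonal block but its square is the
identity, so only the third coordinate survives. *)
Lemma compress_Gamma_swap_pair H c d t :
  compress (corner c) (corner_adj c) (Gamma_par R _ (@swap_pair H d t))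
  = square_axis (c ^+ 2 * t ^+ 2).
Proof.
apply/funext; case; case=> [|[|[|//]]] Hi; apply/funext => u;
  rewrite /compress /corner /corner_adj /square_axis /=.
- by rewrite !scaler0.
- by rewrite !scaler0.
- rewrite /scale_op !scale_realA.
  by congr (_%:C *: _); ring.
Qed.

Lemma compress_square_axis H c s :
  compress (corner c) (corner_adj c) (@square_axis (direct_sum H H) s)
  = square_axis (c ^+ 2 * s).
Proof.
apply/funext => i; apply/funext => u.
rewrite /compress /corner /corner_adj /square_axis; case: ifP => _.
  by rewrite /scale_op /= !scale_realA; congr (_%:C *: _); ring.
by rewrite /= scaler0.
Qed.

(** * Absence of a matrix-convex lift *)

Lemma ReD (x y : R[i]) : complex.Re (x + y) = complex.Re x + complex.Re y.
Proof. by case: x y => [? ?] [? ?]. Qed.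

Lemma Re_realM (a : R) (x : R[i]) : complex.Re (a%:C * x) = a * complex.Re x.
Proof. by case: x => b c; rewrite /= mul0r subr0. Qed.

(** The weights [c1^2] and [c2^2] are balanced so that the third coordinates
[t^2] and [- r] cancel, making the combination the zero tuple. *)
Lemma matrix_convex_square_axis H (U : ncset R 3) (G : ncfun R 3)
    (c1 c2 d t r : R) (u : H) :
  matrix_convex U G ->
  c1 ^+ 2 + c2 ^+ 2 = 1 -> c1 ^+ 2 * t ^+ 2 = c2 ^+ 2 * r ->
  U H (zero_point 3 H) ->
  U (direct_sum H H) (Gamma_par R _ (@swap_pair H d t)) ->
  U (direct_sum H H) (square_axis (- r)) ->
  '[G H (zero_point 3 H) u, u] <=
  '[corner_adj c1 (G _ (Gamma_par R _ (@swap_pair H d t)) (corner c1 u)), u] +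
  '[corner_adj c2 (G _ (square_axis (- r)) (corner c2 u)), u].
Proof.
move=> cG c12 bal U0 Up Uq; pose c (a : 'I_2) := if a == 0 then c1 else c2.
pose Xs (a : 'I_2) : point 3 (direct_sum H H) :=
  if a == 0 then Gamma_par R _ (@swap_pair H d t) else square_axis (- r).
have Z0 : (fun i v =>
      \sum_a compress (corner (c a)) (corner_adj (c a)) (Xs a) i v)
    = zero_point 3 H.
  apply/funext => i; apply/funext => v; rewrite !big_ord_recl big_ord0 addr0.
  rewrite /c /Xs /= compress_Gamma_swap_pair compress_square_axis bal.
  rewrite /square_axis; case: ifP => _; last by rewrite addr0.
  by rewrite /scale_op -scalerDl -rmorphD mulrN subrr scale0r.
have := cG 2 H (fun=> direct_sum H H) (fun a => corner (c a))
  (fun a => corner_adj (c a)) Xs.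
rewrite /= Z0 => /(_ _ _ _ _ U0 u); rewrite !big_ord_recl !big_ord0 addr0.
rewrite linearDl; apply.
- by move=> a; exact: corner_bounded.
- by move=> a; exact: corner_adjoint.
- move=> v; rewrite !big_ord_recl big_ord0 addr0 /corner /corner_adj /=.
  by rewrite !scale_realA -scalerDl -rmorphD /= -!expr2 c12 scale1r.
- by move=> a; rewrite /Xs; case: ifP.
Qed.

(** A lift would decrease at least like [- 2 d sqrt s] along the positive part
of the third axis, while convexity, applied between [- r] and [s], only allows a
decrease linear in [s]. *)
Lemma no_matrix_convex_lift H (u : H) (U : ncset R 3) (G : ncfun R 3) :
  u != 0 ->
  matrix_convex_near (zero_point 3 H) U G ->
  ~ factors_near (Gamma_par R) (all_points R 2) (f_par R)
      (zero_point 2 H) U G.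
Proof.
move=> u0 [U0 fG cG] [N N0 fac].
have [r r0 Ur] := unc_nbhd_zero U0; have [d d0 Nd] := unc_nbhd_zero N0.
have UQ : U (direct_sum H H) (square_axis (- r)).
  apply: Ur; [exact: amplification_zero_sum | exact: sa_square_axis |].
  move=> i; rewrite /square_axis; case: ifP => _.
    by rewrite -[X in opnorm_le _ X](gtr0_norm r0) -normrN; exact: opnorm_scale.
  move=> v; rewrite /hnorm /dot_norm linear0l sqrtC0 mulr_ge0 ?hnorm_ge0 //.
  by rewrite (lecR 0) ltW.
have [UZ GZ] : U H (zero_point 3 H) /\ G H (zero_point 3 H) =1 fun=> 0.
  have [|UZ fG0] := fac H (zero_point 2 H) _ (@sa_zero 2 H).
    apply: Nd (amplification_zero _ _) (@sa_zero _ _) _ => i v.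
    rewrite /hnorm /dot_norm linear0l sqrtC0 mulr_ge0 ?hnorm_ge0 //.
    by rewrite (lecR 0) ltW.
  move: UZ fG0; rewrite Gamma_par_zero => UZ fG0; split=> // v.
  by rewrite -fG0 f_parE addr0.
have [[lG _] _] := freefun_sa fG UQ.
have GQZ a v : G (direct_sum H H) (square_axis (- r)) (a *: v)
    = a *: G (direct_sum H H) (square_axis (- r)) v := linear_opZ a v lG.
pose g : R[i] := '[(G _ (square_axis (- r)) (corner 1 u)).1, u].
pose C := complex.Re g.
pose q := complex.Re '[u, u].
have qE : '[u, u] = q%:C.
  by rewrite /q RRe_real // ger0_real // dnorm_ge0.
have q0 : 0 < q by rewrite -ltcR -qE dnorm_gt0.
have ineq t : 0 < t -> t <= d -> 2 * d * r * q <= t * C.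
  (* The weights [r / s] and [t ^+ 2 / s] sum to one and balance [t ^+ 2]
     against [- r]. *)
  move=> t0 td; pose s := r + t ^+ 2.
  have s0 : 0 < s by rewrite addr_gt0 // exprn_gt0.
  pose c1 := Num.sqrt (r / s); pose c2 := Num.sqrt (t ^+ 2 / s).
  have c1E : c1 ^+ 2 = r / s by rewrite sqr_sqrtr // divr_ge0 ?ltW.
  have c2E : c2 ^+ 2 = t ^+ 2 / s.
    by rewrite sqr_sqrtr // divr_ge0 ?exprn_ge0 ?ltW.
  have UfP : U (direct_sum H H) (Gamma_par R _ (@swap_pair H d t)) /\
      f_par R _ (@swap_pair H d t) =1 G _ (Gamma_par R _ (@swap_pair H d t)).
    apply: fac; last exact: sa_swap_pair.
    apply: Nd; [exact: amplification_zero_sum | exact: sa_swap_pair |].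
    move=> i; rewrite /swap_pair; case: ifP => _.
      rewrite -[X in opnorm_le _ X](gtr0_norm d0) -normrN.
      exact: opnorm_swap.
    by apply: opnorm_leW td _; rewrite -[X in opnorm_le _ X](gtr0_norm t0);
      exact: opnorm_swap.
  have [UP fP] := UfP.
  have c12 : c1 ^+ 2 + c2 ^+ 2 = 1 by rewrite c1E c2E -mulrDl divff ?gt_eqF.
  have bal : c1 ^+ 2 * t ^+ 2 = c2 ^+ 2 * r.
    by rewrite c1E c2E mulrAC [RHS]mulrAC [t ^+ 2 * r]mulrC.
  have := matrix_convex_square_axis u cG c12 bal UZ UP UQ.
  rewrite GZ linear0l -fP f_par_swap_pair.
  have -> : corner c2 u = c2%:C *: corner 1 u.
    by congr (_, _); rewrite /= ?scaler0 ?scale1r.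
  rewrite GQZ /corner_adj /= !scale_realA !linearZl_LR /= -/g qE.
  rewrite -rmorphM lecE => /andP[_].
  rewrite ReD !Re_realM /= -expr2 c2E.
  have -> : c1 * - (2 * d * t) * c1 * q + t ^+ 2 / s * C
      = t / s * (t * C - 2 * d * r * q).
    by rewrite [c1 * _ * c1]mulrAC -expr2 c1E; ring.
  by rewrite pmulr_rge0 ?divr_gt0 // subr_ge0.
(* At this [t], [t * C] is below [d * (r * q)], half of the required bound; the
   summand [r * q] of [k] keeps [t] below [d]. *)
pose k := 1 + r * q + `|C|.
have k0 : 0 < k by rewrite ltr_wpDr // addr_gt0 ?mulr_gt0.
have dk : d * (r * q) / k <= d.
  rewrite ler_pdivrMr // ler_pM2l // /k -addrA addrCA lerDl addr_ge0 //.
have t0 : 0 < d * (r * q) / k by rewrite divr_gt0 ?mulr_gt0.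
have := ineq _ t0 dk; rewrite leNgt => /negP; apply.
have drq : 0 < d * (r * q) by rewrite !mulr_gt0.
rewrite mulrAC ltr_pdivrMr //.
have Ck : C < k by rewrite /k; have := ler_norm C; have := mulr_gt0 r0 q0; lra.
have : d * (r * q) * C < d * (r * q) * k by rewrite ltr_pM2l.
have := mulr_gt0 drq k0; lra.
Qed.

End Germ.

Theorem proposition6p3 (R : realType) :
  [/\ forall D : ncset R 2, real_free_domain D ->
        intrinsically_convex (Gamma_par R) D (f_par R) /\
        intrinsically_concave (Gamma_par R) D (f_par R),
      ~ (exists (U : ncset R 3) (G : ncfun R 3),
           matrix_convex_germ (zero_point 3 (scalar_hilbert R)) U G /\
           factors_near (Gamma_par R) (all_points R 2) (f_par R)
             (zero_point 2 (scalar_hilbert R)) U G) &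
      exists D : ncset R 2,
        [/\ real_free_domain D,
            intrinsically_convex (Gamma_par R) D (f_par R) &
            ~ lift_cartan_convex (Gamma_par R) D (f_par R)]].
Proof.
have one0 : (1 : scalar_hilbert R) != 0 by exact: oner_neq0.
split.
- by move=> D [fD _]; apply: f_par_Gamma_affine; exact: free_sa fD.
- move=> [U [G [[convG _] facG]]].
  exact: no_matrix_convex_lift one0 convG facG.
- exists (all_points R 2); split.
  + exact: all_points_domain.
  + by have [] := @f_par_Gamma_affine R (all_points R 2) (fun _ _ saX => saX).
  + move=> [_ /(_ (scalar_hilbert R) (zero_point 2 _))].
    case; first exact: sa_zero.
    move=> U [G []]; rewrite Gamma_par_zero => convG.
    exact: no_matrix_convex_lift one0 convG.
Qed.
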